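(* For each $i\in\{1,2\}$, let $D_i$ be a set with $|D_i|\ge3$, let $a_i,c_i,0_{\vdash,i}\in D_i$ be pairwise distinct, let $(D_i,\dashv_i)$ be a null semigroup with zero $0_{\dashv,i}\neq a_i$, and define the binary operation $\vdash_i$ on $D_i$ by $$ x\vdash_i y= \begin{cases} c_i,&\text{if }x=y=a_i\\ 0_{\vdash,i},&\text{otherwise}. \end{cases} $$ Then $(D_1,\dashv_1,\vdash_1)\cong(D_2,\dashv_2,\vdash_2)$ if and only if there exists a bijection $\psi:D_1\to D_2$ such that $$ \psi(a_1)=a_2,\quad \psi(c_1)=c_2,\quad \psi(0_{\dashv,1})=0_{\dashv,2},\quad \psi(0_{\vdash,1})=0_{\vdash,2}. $$
   Context: A null semigroup with zero $0$ is a semigroup in which $xy=0$ for all $x,y$. A $g$-dimonoid is a set $D$ with two associative binary operations $\dashv,\vdash$ satisfying, for all $x,y,z\in D$, $(x\dashv y)\dashv z=x\dashv(y\vdash z)$ and $(x\dashv y)\vdash z=x\vdash(y\vdash z)$; the structures $(D_i,\dashv_i,\vdash_i)$ of the claim are $g$-dimonoids. An isomorphism of $g$-dimonoids is a bijection preserving both operations; $\cong$ means that an isomorphism exists. *)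

(* Defs.v *)
From mathcomp Require Import all_boot.
From mathcomp Require Import boolp classical_sets functions cardinality.

Set Implicit Arguments.
Unset Strict Implicit.
Unset Printing Implicit Defensive.

Definition is_null_semigroup (D : Type) (op : D -> D -> D) (zero : D) : Prop :=
  associative op /\ forall x y, op x y = zero.

Record is_gdimonoid (D : Type) (dashv vdash : D -> D -> D) : Prop := IsGDimonoid {
  dashv_assoc : associative dashv;
  vdash_assoc : associative vdash;
  dashv_dashv : forall x y z, dashv (dashv x y) z = dashv x (vdash y z);
  dashv_vdash : forall x y z, vdash (dashv x y) z = vdash x (vdash y z)
}.

Record gDimonoid : Type := GDimonoid {
  gd_carrier :> Type;
  gd_dashv : gd_carrier -> gd_carrier -> gd_carrier;
  gd_vdash : gd_carrier -> gd_carrier -> gd_carrier;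
  gd_axioms : is_gdimonoid gd_dashv gd_vdash
}.

Definition is_gdimonoid_iso (G H : gDimonoid) (f : G -> H) : Prop :=
  [/\ bijective f,
      forall x y, f (gd_dashv x y) = gd_dashv (f x) (f y)
    & forall x y, f (gd_vdash x y) = gd_vdash (f x) (f y)].

Definition gdimonoid_isomorphic (G H : gDimonoid) : Prop :=
  exists f : G -> H, is_gdimonoid_iso f.

(* The carrier is an arbitrary type, so the case distinction is made with the
   classical truth value `[< _ >] rather than with a decidable equality. *)
Definition point_op (D : Type) (a c zero x y : D) : D :=
  if `[< x = a /\ y = a >] then c else zero.

Lemma null_point_is_gdimonoid (D : Type) (a c zv zd : D) (dashv : D -> D -> D) :
  a <> c -> a <> zv -> is_null_semigroup dashv zd -> zd <> a ->
  is_gdimonoid dashv (point_op a c zv).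
Proof.
move=> ac azv [dA d0] zda.
have vNa x y : point_op a c zv x y <> a.
  by rewrite /point_op; case: asboolP => _ /esym.
have vl x y : x <> a -> point_op a c zv x y = zv.
  by rewrite /point_op => xa; case: asboolP => // -[].
have vr x y : y <> a -> point_op a c zv x y = zv.
  by rewrite /point_op => ya; case: asboolP => // -[].
split=> // x y z.
- by rewrite vr // vl.
- by rewrite !d0.
- by rewrite d0 vl // vr.
Qed.

Definition null_point_gdimonoid (D : Type) (a c zv zd : D) (dashv : D -> D -> D)
    (hac : a <> c) (hazv : a <> zv) (hnull : is_null_semigroup dashv zd)
    (hzd : zd <> a) : gDimonoid :=
  GDimonoid (null_point_is_gdimonoid hac hazv hnull hzd).

(* Main.v *)
Require Import Defs.
From mathcomp Require Import all_boot.
From mathcomp Require Import boolp classical_sets functions cardinality.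

Local Open Scope classical_set_scope.
Local Open Scope card_scope.

(** The distinguished points can be read off from the two operations. The
    constant value of the null operation is its zero. For [point_op a c z] the
    element [z] is the only absorbing element, because [z] differs from [a],
    and [(a, a)] is the only pair whose product is not [z], because [c] differs
    from [z]; its product is [c]. An isomorphism therefore carries each
    distinguished point to its counterpart ([null_morphP], [point_op_morphP]).
    Conversely, both operations are defined from these points and equality
    alone, so a bijection that matches the points preserves the operations. *)

Lemma null_morphP (D1 D2 : Type) (op1 : D1 -> D1 -> D1) (op2 : D2 -> D2 -> D2)
    (z1 : D1) (z2 : D2) (f : D1 -> D2) :
  is_null_semigroup op1 z1 -> is_null_semigroup op2 z2 ->
  (forall x y, f (op1 x y) = op2 (f x) (f y)) <-> f z1 = z2.
Proof.
move=> [_ op1E] [_ op2E]; split=> [fM|fz x y]; last by rewrite op1E op2E.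
by rewrite -(op1E z1 z1) fM op2E.
Qed.

Lemma point_op_point (D : Type) (a c z : D) : point_op a c z a a = c.
Proof. by rewrite /point_op asboolT. Qed.

Lemma point_op_neqr (D : Type) (a c z x y : D) :
  y <> a -> point_op a c z x y = z.
Proof. by move=> ya; rewrite /point_op asboolF // => -[]. Qed.

Lemma point_op_neql (D : Type) (a c z x y : D) :
  x <> a -> point_op a c z x y = z.
Proof. by move=> xa; rewrite /point_op asboolF // => -[]. Qed.

Lemma point_op_inj (D1 D2 : Type) (a c z x y : D1) (f : D1 -> D2) :
  injective f ->
  f (point_op a c z x y) = point_op (f a) (f c) (f z) (f x) (f y).
Proof.
move=> f_inj; rewrite /point_op; case: asboolP => [[-> ->]|xyNa].
  by rewrite asboolT.
by rewrite asboolF // => -[/f_inj xa /f_inj ya]; apply: xyNa.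
Qed.

(** A bijective morphism maps the absorbing element [z1] to [z2], since [z2]
    absorbs and has a preimage. The product of [f a1] with itself is [f c1],
    which differs from [f z1 = z2] by injectivity, and only the pair [(a2, a2)]
    has such a product. *)
Lemma point_op_morphP (D1 D2 : Type) (a1 c1 z1 : D1) (a2 c2 z2 : D2)
    (f : D1 -> D2) :
  bijective f -> a1 <> z1 -> c1 <> z1 -> a2 <> z2 ->
  (forall x y, f (point_op a1 c1 z1 x y) = point_op a2 c2 z2 (f x) (f y)) <->
  [/\ f a1 = a2, f c1 = c2 & f z1 = z2].
Proof.
move=> f_bij az1 cz1 az2; have f_inj := bij_inj f_bij.
split=> [fM|[<- <- <-] x y]; last exact: point_op_inj.
have fz : f z1 = z2.
  have [g _ fK] := f_bij.
  rewrite -(@point_op_neql _ a1 c1 z1 z1 (g z2)); last exact/nesym.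
  by rewrite fM fK point_op_neqr //; apply/nesym.
have fc : f c1 = point_op a2 c2 z2 (f a1) (f a1).
  by rewrite -fM point_op_point.
have fa : f a1 = a2.
  apply: contrapT => faNa; apply: cz1; apply: f_inj.
  by rewrite fz fc point_op_neql.
by split=> //; rewrite fc fa point_op_point.
Qed.

Theorem proposition3p6
    (D1 D2 : Type)
    (hD1 : `I_3 #<= [set: D1]) (hD2 : `I_3 #<= [set: D2])
    (a1 c1 zv1 : D1) (a2 c2 zv2 : D2)
    (hac1 : a1 <> c1) (hazv1 : a1 <> zv1) (hczv1 : c1 <> zv1)
    (hac2 : a2 <> c2) (hazv2 : a2 <> zv2) (hczv2 : c2 <> zv2)
    (dashv1 : D1 -> D1 -> D1) (zd1 : D1)
    (dashv2 : D2 -> D2 -> D2) (zd2 : D2)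
    (hnull1 : is_null_semigroup dashv1 zd1) (hzd1 : zd1 <> a1)
    (hnull2 : is_null_semigroup dashv2 zd2) (hzd2 : zd2 <> a2) :
  gdimonoid_isomorphic
    (null_point_gdimonoid hac1 hazv1 hnull1 hzd1)
    (null_point_gdimonoid hac2 hazv2 hnull2 hzd2)
  <->
  exists psi : D1 -> D2,
    bijective psi /\ psi a1 = a2 /\ psi c1 = c2 /\ psi zd1 = zd2 /\ psi zv1 = zv2.
Proof.
split=> [[f [f_bij fd fv]]|[f [f_bij [fa [fc [fzd fzv]]]]]]; exists f.
  have /(null_morphP _ _ _ _ _ _ _ hnull1 hnull2) fzd := fd.
  have [] // := (point_op_morphP _ _ a1 c1 zv1 a2 c2 zv2 f _ _ _ _).1 fv.
split=> //; first exact/(null_morphP _ _ _ _ _ _ _ hnull1 hnull2).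
exact/(point_op_morphP _ _ a1 c1 zv1 a2 c2 zv2).
Qed.
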